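(* Consider a nonlinear quantum system $$d\bar a(t)=\bar A(a(t),a(t)^\dagger)\,dt+\bar B(a(t),a(t)^\dagger)\,d\bar W(t),\qquad d\bar y(t)=\bar C(a(t),a(t)^\dagger)\,dt+\bar D(a(t),a(t)^\dagger)\,d\bar W(t)$$ of the class described in the context. The system is physically realizable with $T_{\bar w}=\bar J=\begin{bmatrix}I&0\\ 0&-I\end{bmatrix}$ if and only if $$\left[\bar A(a,a^\dagger),\bar a^\dagger\right]+\left[\bar a,\bar A(a,a^\dagger)^\dagger\right]+\bar B(a,a^\dagger)\,\bar J\,\bar B(a,a^\dagger)^\dagger=0,$$ $$\left[\bar B(a,a^\dagger),\bar a^\dagger\right]=0,\qquad \left[\bar a,\bar B(a,a^\dagger)^\dagger\right]=0,$$ $$\bar B(a,a^\dagger)=\left[\bar C(a,a^\dagger)^\dagger,\bar a\right]\bar J\qquad\text{and}\qquad \bar D(a,a^\dagger)=I.$$ In this case, the corresponding nonlinear self-adjoint Hamiltonian $\bar H$ is given by $$\bar H=\frac{i}{2\bar n}\left(\bar a^\dagger\bar\Theta^{-1}\bar A(a,a^\dagger)-\bar A(a,a^\dagger)^\dagger\bar\Theta^{-1}\bar a\right),$$ where $\bar n$ is the number defined in the context, and the corresponding coupling operator is $\bar L=\bar C(a,a^\dagger)$.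
   Context: Notation. For operators, $[X,Y]=XY-YX$ and $X^*$ is the operator adjoint. For a vector or matrix $M$ of operators, $M^T$ is the transpose, $M^*$ is the entrywise adjoint (complex conjugate for a complex matrix), and $M^\dagger=(M^* )^T$. For column vectors $x,z$ of operators, $[x,z^\dagger]=xz^\dagger-(z^*x^T)^T$ is the matrix with $(j,k)$ entry $[x_j,z_k^*]$; $[x,z^T]$ is the matrix with entries $[x_j,z_k]$; and $[z^\dagger,x]$ is the matrix with $(j,k)$ entry $[z_k^*,x_j]$. For a single operator $X$, $[X,x]$ is the column vector with entries $[X,x_j]$. For a matrix $M$ of operators, $[M,x^\dagger]=0$ means $[M_{jk},x_l^*]=0$ for all $j,k,l$, and $[x,M^\dagger]=0$ means $[x_l,M_{jk}^*]=0$ for all $j,k,l$. The time argument of $a=a(t)$ is often suppressed. Variables. $a=(a_1,\dots,a_n)^T$ is the vector of system (annihilation) operators on a Hilbert space and $W=(W_1,\dots,W_m)^T$ is the vector of input field processes on a Fock space. Put $\bar a=\begin{bmatrix}a\\ a^*\end{bmatrix}$ and $\bar W=\begin{bmatrix}W\\ W^*\end{bmatrix}$. The evolution of $a$ is $da=A(a,a^\dagger)dt+B(a,a^\dagger)dW$ and the output is $dy=C(a)dt+D\,dW$, with $A(a,a^\dagger)$ a vector of $n$ operators, $B(a,a^\dagger)$ an $n\times m$ matrix of operators, $C(a)$ a vector of $m$ operators, and $D$ an $m\times m$ matrix. Put $$\bar y=\begin{bmatrix}y\\ y^*\end{bmatrix},\quad \bar A=\begin{bmatrix}A\\ A^*\end{bmatrix},\quad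 \bar B=\begin{bmatrix}B&0\\ 0&B^*\end{bmatrix},\quad \bar C=\begin{bmatrix}C\\ C^*\end{bmatrix},\quad \bar D=\begin{bmatrix}D&0\\ 0&D^*\end{bmatrix}.$$ The system variables satisfy $[a,a^\dagger]=\Theta$ at $t=0$, with $\Theta$ a complex $n\times n$ matrix, and $[\bar a,\bar a^\dagger]=\bar\Theta=\begin{bmatrix}\Theta&0\\ 0&-\Theta^*\end{bmatrix}$; $\bar\Theta$ is assumed invertible. Class of systems. All systems considered satisfy $[C(a),a^T]=0$, $[A(a,a^\dagger),a^T]=-[a,A(a,a^\dagger)^T]$, and $$A_i(a,a^\dagger)=\sum_{k_i=0}^{m_{k_i}}\sum_{h_i=0}^{m_{h_i}}\sum_{l=1}^n\sum_{p=1}^n\alpha_{plk_ih_i}\,a_p^{k_i}(a_l^* )^{h_i},\qquad C_v(a)=\sum_{k_v=0}^{m_{k_v}}\sum_{p=1}^n\beta_{k_vp}\,a_p^{k_v}$$ for $i=1,\dots,n$, $v=1,\dots,m$, where $m_{k_i},m_{h_i},m_{k_v},\beta_{k_vp}$ and $\alpha_{plk_ih_i}$ are integers. Moreover $$\frac1{2\bar n}\left[\bar A(a,a^\dagger)^\dagger\bar\Theta^{-1}\bar a,\bar a\right]-\frac1{2\bar n}\left[\bar a^\dagger\bar\Theta^{-1}\bar A(a,a^\dagger),\bar a\right]=\bar A(a,a^\dagger)-\frac12\bar B(a,a^\dagger)\bar C(a,a^\dagger),$$ where $\bar n=\sup_{1\le i\le n}(k_i+h_i)$, the supremum being taken over indices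 with $\alpha_{plk_ih_i}\neq0$. Noise. $dW(t)=\beta_w(t)dt+d\tilde w(t)$, where $\beta_w$ is an adapted process and $\tilde w$ is a vector of quantum Wiener processes (operators on a Fock space) with Ito table $d\tilde w\,d\tilde w^\dagger=F_{\tilde w}dt$, $F_{\tilde w}$ a nonnegative definite Hermitian matrix, and commutation relations $[d\tilde w,d\tilde w^\dagger]=d\tilde w\,d\tilde w^\dagger-(d\tilde w^*d\tilde w^T)^T=T_w\,dt$ with $T_w$ Hermitian; put $T_{\bar w}=\begin{bmatrix}T_w&0\\ 0&-T_w^*\end{bmatrix}$. The operator $\beta_w(0)$ acts on a Hilbert space distinct from those of $a(0)$ and of the noise; $\beta_w(t)$ commutes with $a(t)$ and with $d\tilde w(t)$ for all $t\ge0$; and $[a,dW^\dagger]=0$. Physical realizability. The system is physically realizable if it is a representation of a nonlinear open quantum harmonic oscillator defined by a nonlinear coupling operator $\bar L$ (a vector of $2m$ operators) and a nonlinear Hamiltonian $\bar H$, i.e. if there exist $\bar H$ and $\bar L$ such that $$\bar A(a,a^\dagger)=\tfrac12[\bar L^\dagger,\bar a]\bar J\bar L+i[\bar H,\bar a],\quad \bar B(a,a^\dagger)=[\bar L^\dagger,\bar a]\bar J,\quad \bar C(a,a^\dagger)=\bar L,\quad \bar D(a,a^\dagger)=I,$$ where $\bar J=\begin{bmatrix}I&0\\ 0&-I\end{bmatrix}$ with $m\times m$ blocks. The ''corresponding'' $\bar H$ and $\bar L$ are operators satisfying these equations.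
   Formalization: The a_j(0) are taken to be annihilation operators in the strict sense, with a common nonzero vacuum vector, so Θ is positive definite; for merely invertible Θ, such as Θ=[[0,1],[1,0]] with C=a_1^2, the equivalence fails. At times t>0 the relations [ā,ā†]=Θ̄ are assumed. *)

(* Defs.v *)
From HB Require Import structures.
From mathcomp Require Export all_boot all_order all_algebra.
From mathcomp Require Export complex.
From mathcomp Require Export boolp classical_sets reals.

Set Implicit Arguments.
Unset Strict Implicit.
Unset Printing Implicit Defensive.

Import Order.TTheory GRing.Theory Num.Theory.
Local Open Scope ring_scope.

(* Unbounded operators.  V is the inner product space carrying the operators:
   a common invariant dense domain of a Hilbert space (its completion).  An
   operator is a map V -> V together with an adjoint V -> V; linearity follows
   from the existence of the adjoint, and the adjoint is unique.  The form
   [dot] is linear in its first argument and conjugate-linear in the second. *)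
Record op (R : realType) (V : lmodType R[i])
    (dot : {dot V for (Num.conj : R[i] -> R[i])}) := MkOp {
  op_fun :> V -> V;
  op_adj : V -> V;
  op_adjP : forall u v, dot (op_fun u) v = dot u (op_adj v) }.

Section OperatorAlgebra.
Variables (R : realType) (V : lmodType R[i]).
Variable dot : {dot V for (Num.conj : R[i] -> R[i])}.
Local Notation Op := (op dot).
Implicit Types X Y Z : Op.

Lemma dot_inj v w : (forall u, dot u v = dot u w) -> v = w.
Proof.
move=> h; apply/eqP; rewrite -subr_eq0 -(dnorm_eq0 dot).
by rewrite linearBr /= h subrr.
Qed.

Lemma dotC u v : dot u v = (dot v u)^*.
Proof. by rewrite (hermC dot) /= expr0 mul1r. Qed.

Lemma op_adjP' X u v : dot (op_adj X u) v = dot u (X v).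
Proof. by rewrite dotC -(op_adjP X) -dotC. Qed.

Lemma op_eq X Y : X =1 Y -> X = Y.
Proof.
case: X Y => [f f' fP] [g g' gP] /= /funext efg; move: fP gP; rewrite efg => fP gP.
have e : f' = g'.
  by apply/funext => v; apply: dot_inj => u; rewrite -fP -gP.
by case: g' / e gP => gP; rewrite (Prop_irrelevance fP gP).
Qed.

Lemma opD X u v : X (u + v) = X u + X v.
Proof.
apply: dot_inj => w; rewrite -op_adjP' !linearDr /=.
by rewrite !op_adjP'.
Qed.

Lemma opZ X c u : X (c *: u) = c *: X u.
Proof.
apply: dot_inj => w; rewrite -op_adjP' !linearZr_LR /=.
by rewrite !op_adjP'.
Qed.

Definition adj X : Op := MkOp (op_adjP' X).

Fact op_zeroP u v : dot 0 v = dot u 0.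
Proof. by rewrite linear0l linear0r. Qed.
Definition op_zero : Op := @MkOp R V dot (fun _ => 0) (fun _ => 0) op_zeroP.

Fact op_addP X Y u v : dot (X u + Y u) v = dot u (adj X v + adj Y v).
Proof. by rewrite linearDl linearDr /= (op_adjP X) (op_adjP Y). Qed.
Definition op_add X Y : Op :=
  @MkOp R V dot (fun u => X u + Y u) (fun v => adj X v + adj Y v) (op_addP X Y).

Fact op_oppP X u v : dot (- X u) v = dot u (- adj X v).
Proof. by rewrite linearNl linearNr /= (op_adjP X). Qed.
Definition op_opp X : Op :=
  @MkOp R V dot (fun u => - X u) (fun v => - adj X v) (op_oppP X).

Definition op_one : Op :=
  @MkOp R V dot (fun u => u) (fun v => v) (fun _ _ => erefl).

Fact op_mulP X Y u v : dot (X (Y u)) v = dot u (adj Y (adj X v)).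
Proof. by rewrite (op_adjP X) (op_adjP Y). Qed.
Definition op_mul X Y : Op :=
  @MkOp R V dot (fun u => X (Y u)) (fun v => adj Y (adj X v)) (op_mulP X Y).

Fact op_scaleP (c : R[i]) X u v : dot (c *: X u) v = dot u (c^* *: adj X v).
Proof. by rewrite linearZl_LR linearZr_LR /= conjCK (op_adjP X). Qed.
Definition op_scale (c : R[i]) X : Op :=
  @MkOp R V dot (fun u => c *: X u) (fun v => c^* *: adj X v) (op_scaleP c X).

HB.instance Definition _ := gen_eqMixin Op.
HB.instance Definition _ := gen_choiceMixin Op.

Fact op_addA : associative op_add.
Proof. by move=> X Y Z; apply: op_eq => u /=; rewrite addrA. Qed.
Fact op_addC : commutative op_add.
Proof. by move=> X Y; apply: op_eq => u /=; rewrite addrC. Qed.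
Fact op_add0 : left_id op_zero op_add.
Proof. by move=> X; apply: op_eq => u /=; rewrite add0r. Qed.
Fact op_addN : left_inverse op_zero op_opp op_add.
Proof. by move=> X; apply: op_eq => u /=; rewrite addNr. Qed.

HB.instance Definition _ :=
  GRing.isZmodule.Build Op op_addA op_addC op_add0 op_addN.

Fact op_mulA : associative op_mul.
Proof. by move=> X Y Z; apply: op_eq. Qed.
Fact op_mul1 : left_id op_one op_mul.
Proof. by move=> X; apply: op_eq. Qed.
Fact op_mulr1 : right_id op_one op_mul.
Proof. by move=> X; apply: op_eq. Qed.
Fact op_mulDl : left_distributive op_mul op_add.
Proof. by move=> X Y Z; apply: op_eq. Qed.
Fact op_mulDr : right_distributive op_mul op_add.
Proof. by move=> X Y Z; apply: op_eq => u /=; rewrite opD. Qed.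

HB.instance Definition _ :=
  GRing.Zmodule_isPzRing.Build Op op_mulA op_mul1 op_mulr1 op_mulDl op_mulDr.

Fact op_scaleA c d X : op_scale c (op_scale d X) = op_scale (c * d) X.
Proof. by apply: op_eq => u /=; rewrite scalerA. Qed.
Fact op_scale1 : left_id 1 op_scale.
Proof. by move=> X; apply: op_eq => u /=; rewrite scale1r. Qed.
Fact op_scaleDr : right_distributive op_scale +%R.
Proof. by move=> c X Y; apply: op_eq => u /=; rewrite scalerDr. Qed.
Fact op_scaleDl X : {morph op_scale^~ X : c d / c + d}.
Proof. by move=> c d; apply: op_eq => u /=; rewrite scalerDl. Qed.

HB.instance Definition _ := GRing.Zmodule_isLmodule.Build R[i] Op
  op_scaleA op_scale1 op_scaleDr op_scaleDl.

End OperatorAlgebra.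

Section MatricesOfOperators.
Variables (R : realType) (V : lmodType R[i]).
Variable dot : {dot V for (Num.conj : R[i] -> R[i])}.
Local Notation Op := (op dot).

Definition comm (X Y : Op) : Op := X * Y - Y * X.

(* M^* and M^\dagger for matrices of operators *)
Definition adjmx p q (M : 'M[Op]_(p, q)) : 'M[Op]_(p, q) := map_mx (@adj R V dot) M.
Definition dag p q (M : 'M[Op]_(p, q)) : 'M[Op]_(q, p) := (adjmx M)^T.

Definition scmx p q (M : 'M[R[i]]_(p, q)) : 'M[Op]_(p, q) :=
  map_mx (fun c => c *: (1 : Op)) M.

(* multiplication of a matrix of operators by a complex number (the library's
   *: on these matrices takes its scalars in the ring of operators) *)
Definition cscale p q (c : R[i]) (M : 'M[Op]_(p, q)) : 'M[Op]_(p, q) :=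
  map_mx (fun X => c *: X) M.

(* [x, z^T], [x, z^\dagger], [z^\dagger, x] and [X, x] for columns x, z *)
Definition commT p q (x : 'cV[Op]_p) (z : 'cV[Op]_q) : 'M[Op]_(p, q) :=
  \matrix_(j, k) comm (x j 0) (z k 0).
Definition commD p q (x : 'cV[Op]_p) (z : 'cV[Op]_q) : 'M[Op]_(p, q) :=
  \matrix_(j, k) comm (x j 0) (adj (z k 0)).
Definition Dcomm p q (z : 'cV[Op]_q) (x : 'cV[Op]_p) : 'M[Op]_(p, q) :=
  \matrix_(j, k) comm (adj (z k 0)) (x j 0).
Definition commC p (X : Op) (x : 'cV[Op]_p) : 'cV[Op]_p :=
  \col_j comm X (x j 0).

(* [M, x^\dagger] = 0 and [x, M^\dagger] = 0 for a matrix M and a column x *)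
Definition commMD0 p q r (M : 'M[Op]_(p, q)) (x : 'cV[Op]_r) : Prop :=
  forall j k l, comm (M j k) (adj (x l 0)) = 0.
Definition commDM0 p q r (x : 'cV[Op]_r) (M : 'M[Op]_(p, q)) : Prop :=
  forall j k l, comm (x l 0) (adj (M j k)) = 0.

(* barcN M is diag(M, - M^* ), as in \bar Theta and T_{\bar w} *)
Definition bar p (x : 'cV[Op]_p) : 'cV[Op]_(p + p) := col_mx x (adjmx x).
Definition barmx p q (M : 'M[Op]_(p, q)) : 'M[Op]_(p + p, q + q) :=
  block_mx M 0 0 (adjmx M).
Definition cconj p q (M : 'M[R[i]]_(p, q)) : 'M[R[i]]_(p, q) :=
  map_mx (Num.conj : R[i] -> R[i]) M.
Definition barc p q (M : 'M[R[i]]_(p, q)) : 'M[R[i]]_(p + p, q + q) :=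
  block_mx M 0 0 (cconj M).
Definition barcN p (M : 'M[R[i]]_p) : 'M[R[i]]_(p + p) :=
  block_mx M 0 0 (- cconj M).
Definition Jbar p : 'M[R[i]]_(p + p) := block_mx 1%:M 0 0 (- 1%:M).

End MatricesOfOperators.

Notation "c *:m M" := (cscale c M)
  (at level 40, left associativity) : ring_scope.

(* Coefficients of a system with n modes and m fields.  [alpha i p l k h] is the
   coefficient of a_p^k (a_l^* )^h in A_i, and [beta v k p] that of a_p^k in C_v.
   [Bfun x z] is B as a function of x = a and z = a^*. *)
Record nlsystem (R : realType) (V : lmodType R[i])
    (dot : {dot V for (Num.conj : R[i] -> R[i])}) (n m : nat) := NLSystem {
  kdeg : 'I_n -> nat;
  hdeg : 'I_n -> nat;
  alpha : 'I_n -> 'I_n -> 'I_n -> nat -> nat -> int;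
  cdeg : 'I_m -> nat;
  beta : 'I_m -> nat -> 'I_n -> int;
  Bfun : 'cV[op dot]_n -> 'cV[op dot]_n -> 'M[op dot]_(n, m);
  Dmat : 'M[R[i]]_m;
  Theta : 'M[R[i]]_n }.

Section Systems.
Variables (R : realType) (V : lmodType R[i]).
Variable dot : {dot V for (Num.conj : R[i] -> R[i])}.
Variables (n m : nat) (S : nlsystem dot n m).
Local Notation Op := (op dot).
Implicit Types x : 'cV[Op]_n.

Definition Acoef x : 'cV[Op]_n := \col_i
  \sum_(k < (kdeg S i).+1) \sum_(h < (hdeg S i).+1) \sum_(l < n) \sum_(p < n)
    (x p 0 ^+ k * adj (x l 0) ^+ h) *~ alpha S i p l k h.
Definition Ccoef x : 'cV[Op]_m := \col_v
  \sum_(k < (cdeg S v).+1) \sum_(p < n) (x p 0 ^+ k) *~ beta S v k p.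
Definition Bcoef x : 'M[Op]_(n, m) := Bfun S x (adjmx x).

Definition Abar x := bar (Acoef x).
Definition Bbar x := barmx (Bcoef x).
Definition Cbar x := bar (Ccoef x).
Definition Dbar : 'M[R[i]]_(m + m) := barc (Dmat S).
Definition Thetabar : 'M[R[i]]_(n + n) := barcN (Theta S).
Local Notation ThetaI := (scmx dot (invmx Thetabar)).
Local Notation J := (scmx dot (Jbar R m)).

Definition nbar : nat :=
  \max_(i < n) \max_(k < (kdeg S i).+1) \max_(h < (hdeg S i).+1)
  \max_(l < n) \max_(p < n | alpha S i p l k h != 0) (k + h).

(* [a, a^\dagger] = Theta and [abar, abar^\dagger] = Thetabar; the latter also
   says that the entries of a commute with each other. *)
Definition ccr x : Prop :=
  commD x x = scmx dot (Theta S) /\ commD (bar x) (bar x) = scmx dot Thetabar.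

(* The scalars \bar A^\dagger \bar Theta^-1 \bar a and
   \bar a^\dagger \bar Theta^-1 \bar A *)
Definition AdTa x : Op := (dag (Abar x) *m ThetaI *m bar x) 0 0.
Definition adTA x : Op := (dag (bar x) *m ThetaI *m Abar x) 0 0.

(* 0 < nbar is what gives the factor 1/(2 nbar) a meaning. *)
Definition in_class x : Prop :=
  [/\ commT (Ccoef x) x = 0,
      commT (Acoef x) x = - commT x (Acoef x),
      (0 < nbar)%N &
      (2 * nbar%:R)^-1 *:m commC (AdTa x) (bar x)
        - (2 * nbar%:R)^-1 *:m commC (adTA x) (bar x)
      = Abar x - 2^-1 *:m (Bbar x *m Cbar x)].

Definition realizes x (H : Op) (L : 'cV[Op]_(m + m)) : Prop :=
  [/\ Abar x = 2^-1 *:m (Dcomm L (bar x) *m J *m L) + 'i *:m commC H (bar x),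
      Bbar x = Dcomm L (bar x) *m J,
      Cbar x = L &
      Dbar = 1%:M].

Definition physically_realizable x : Prop := exists H L, realizes x H L.

Definition realizability_conditions x : Prop :=
  [/\ commD (Abar x) (bar x) + commD (bar x) (Abar x)
        + Bbar x *m J *m dag (Bbar x) = 0,
      commMD0 (Bbar x) (bar x),
      commDM0 (bar x) (Bbar x),
      Bbar x = Dcomm (Cbar x) (bar x) *m J &
      Dbar = 1%:M].

Definition Hbar x : Op := ('i / (2 * nbar%:R)) *: (adTA x - AdTa x).

(* Annihilation operators have a common nonzero (vacuum) vector in their kernels.
   With ccr and the invertibility of Thetabar this makes Theta positive definite.
   It matters: without it, n = 2, m = 1, Theta = [[0,1],[1,0]], C = a_1^2,
   A = (0, - a_1^2 a_1^* ), B = (0, - 2 a_1^* ), D = 1 is in the class and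
   realizable (H = 0, L = \bar C), whereas [\bar B, \bar a^\dagger] <> 0. *)
Definition annihilation_operators x : Prop :=
  exists2 vac : V, vac != 0 & forall j, x j 0 vac = 0.

End Systems.

(* Quantum stochastic calculus.  A process is a function of time t >= 0; limits
   are taken weakly, along partitions 0 = s_0 <= ... <= s_N = t whose mesh goes
   to 0, and Ito integrals are limits of left-point Riemann sums. *)
Section Stochastics.
Variables (R : realType) (V : lmodType R[i]).
Variable dot : {dot V for (Num.conj : R[i] -> R[i])}.
Local Notation Op := (op dot).
Local Notation process p := (R -> 'cV[Op]_p).

Definition incr p (z : process p) (s t : R) : 'cV[Op]_p := z t - z s.

Definition partition_of (t delta : R) (N : nat) (s : nat -> R) : Prop :=
  [/\ s 0%N = 0, s N = t &
      forall i, (i < N)%N -> s i <= s i.+1 < s i + delta].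

(* X is the weak limit of the sums over i < N of G (s_i) (s_(i+1)) *)
Definition weak_partition_limit (t : R) (G : R -> R -> Op) (X : Op) : Prop :=
  forall (u v : V) (eps : R), 0 < eps -> exists2 delta, 0 < delta &
    forall N s, partition_of t delta N s ->
      `| dot ((\sum_(i < N) G (s i) (s i.+1) - X) u) v | < (eps%:C)%C.

(* dx = f dt + G dz *)
Definition qsde p q (x f : process p) (G : R -> 'M[Op]_(p, q)) (z : process q) :=
  forall t, 0 <= t -> forall j,
    weak_partition_limit t
      (fun s s' => (((s' - s)%:C)%C *:m f s + G s *m incr z s s') j 0)
      (incr x 0 t j 0).

(* dz dz^\dagger = F dt *)
Definition ito_table q (z : process q) (F : 'M[R[i]]_q) : Prop :=
  forall t, 0 <= t -> forall j k,
    weak_partition_limit t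
      (fun s s' => incr z s s' j 0 * adj (incr z s s' k 0))
      ((((t%:C)%C * F j k) : R[i]) *: (1 : Op)).

Definition hermmx q (M : 'M[R[i]]_q) : Prop := (cconj M)^T = M.
Definition nonneg_hermmx q (M : 'M[R[i]]_q) : Prop :=
  hermmx M /\ forall z : 'cV[R[i]]_q, 0 <= ((cconj z)^T *m M *m z) 0 0.

(* X commutes with z_k and z_k^* *)
Definition commutes_with q (X : Op) (z : 'cV[Op]_q) : Prop :=
  forall k, comm X (z k 0) = 0 /\ comm X (adj (z k 0)) = 0.

Definition quantum_wiener q (w : process q) (F T : 'M[R[i]]_q) : Prop :=
  [/\ w 0 = 0,
      nonneg_hermmx F /\ ito_table w F,
      hermmx T,
      forall s t, 0 <= s -> s <= t ->
        commD (incr w s t) (incr w s t) = scmx dot (((t - s)%:C)%C *: T) &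
      forall s t u v, 0 <= s -> s <= t -> t <= u -> u <= v ->
        forall k, commutes_with (incr w s t k 0) (incr w u v)].

Definition star_subalgebra (N : set Op) : Prop :=
  [/\ N 1,
      forall c X Y, N X -> N Y -> N (c *: X + Y),
      forall X Y, N X -> N Y -> N (X * Y) &
      forall X, N X -> N (adj X)].

(* Filtration of the noise w: the operators of the past N t contain the noise up
   to time t and act on another tensor factor than the increments after t. *)
Definition noise_filtration q (w : process q) (N : R -> set Op) : Prop :=
  [/\ forall t, 0 <= t -> star_subalgebra (N t),
      forall s t, 0 <= s -> s <= t -> (N s `<=` N t)%classic,
      forall t, 0 <= t -> forall k, N t (w t k 0) &
      forall t u v X, 0 <= t -> t <= u -> u <= v -> N t X ->
        commutes_with X (incr w u v)].

Definition adapted q (N : R -> set Op) (z : process q) : Prop :=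
  forall t, 0 <= t -> forall k, N t (z t k 0).

(* dW = bw dt + dw, for a system with variables a.  Acting on a Hilbert space
   distinct from that of other operators (another tensor factor) is rendered as
   commuting with these operators and their adjoints; [a, dW^\dagger] = 0 is
   stated on the dt and dw components of dW. *)
Definition input_field n m (a : process n) (W bw w : process m)
    (F T : 'M[R[i]]_m) : Prop :=
  quantum_wiener w F T /\
  (exists N, [/\ noise_filtration w N, forall j, N 0 (a 0 j 0) & adapted N bw]) /\
  qsde W bw (fun _ => 1%:M) w /\
  (forall k, commutes_with (bw 0 k 0) (a 0)) /\
  (forall k t, 0 <= t -> commutes_with (bw 0 k 0) (w t)) /\
  (forall t, 0 <= t -> commT (bw t) (a t) = 0) /\
  (forall t t', 0 <= t -> t <= t' -> commT (bw t) (incr w t t') = 0) /\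
  (forall t, 0 <= t -> commD (a t) (bw t) = 0) /\
  (forall t t', 0 <= t -> t <= t' -> commD (a t) (incr w t t') = 0).

End Stochastics.

(* Main.v *)
From HB Require Import structures.
Require Import Defs.
Import Order.TTheory GRing.Theory Num.Theory.
Local Open Scope ring_scope.

(** At a fixed time everything reduces to algebra in the ring of operators.  Let
    [x] be the system variables.

    The Hamiltonian.  The canonical commutation relations make [Thetabar]
    Hermitian, so [AdTa] is the adjoint of [adTA] and [Hbar] is self-adjoint.  The
    last equation of the class says exactly
    [Abar = 1/2 Bbar Cbar + i [Hbar, abar]] ([Abar_Hbar]).  Hence, given the
    coupling equation [Bbar = [Cbar^dagger, abar] J], the operators [Hbar] and
    [Cbar] realize the system; this gives one implication and the formulas for
    the Hamiltonian and the coupling operator.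

    The converse rests on the fact that a realizable system of the class has
    couplings [C_v] of degree at most one, so that the entries of [Bbar] are
    scalars.  Indeed the lower half of [Abar] is the entrywise adjoint of its upper
    half; comparing the two in [Abar_Hbar] cancels the Hamiltonian and leaves
    [\sum_v [B_jv, C_v] = 0] ([sum_comm_B_C]).  As [B_jv = [C_v^*, a_j]], the
    Jacobi identity turns this into: [N = \sum_v [C_v, C_v^*]] commutes with every
    [a_j] and [a_j^*].  Let [c] be the combination of the [a_l^*] dual to [a_j],
    that is, [[a_p, c] = 1] if [p = j] and [0] otherwise.  The commutator with
    [c] differentiates [C_v], a sum of one-variable polynomials, with respect to
    [a_j], and the commutator with [c^*] does the same to [C_v^*].
    Differentiating [N] in this way, [d - 1] times on each side where [d >= 2] is
    the largest degree in [a_j] of the [C_v], leaves only the top coefficients: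
    [Theta_jj (d!)^2 \sum_v beta_v^2 = 0] ([top_coefficients_eq0]).  The
    coefficients are integers, and [Theta_jj] is nonzero because the variables
    annihilate a vacuum vector at time 0 ([vacuum_Theta_neq0]).

    Once the entries of [Bbar] are scalars, the two commutation conditions are
    clear.  In the preservation equation the Hamiltonian contributes
    [i [H, [abar_j, abar_l^*]] = 0] by Jacobi, and each of the two terms coming from
    [1/2 Bbar Cbar] contributes half of [- Bbar J Bbar^dagger] ([preservation]). *)

Set Implicit Arguments.
Unset Strict Implicit.
Unset Printing Implicit Defensive.

(** * Commutators and adjoints *)

Section Commutators.
Variables (R : realType) (V : lmodType R[i]).
Variable dot : {dot V for (Num.conj : R[i] -> R[i])}.
Local Notation Op := (op dot).
Implicit Types X Y Z : Op.

Lemma scale_mull c X Y : (c *: X) * Y = c *: (X * Y).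
Proof. exact: op_eq. Qed.

Lemma scale_mulr c X Y : X * (c *: Y) = c *: (X * Y).
Proof. by apply: op_eq => u /=; rewrite opZ. Qed.

Lemma adjK X : adj (adj X) = X.
Proof. exact: op_eq. Qed.

Lemma adj_is_additive : zmod_morphism (@adj R V dot).
Proof. by move=> X Y; apply: op_eq. Qed.

HB.instance Definition _ :=
  GRing.isZmodMorphism.Build Op Op (@adj R V dot) adj_is_additive.

Lemma adjM X Y : adj (X * Y) = adj Y * adj X.
Proof. exact: op_eq. Qed.

Lemma adj1 : adj (1 : Op) = 1.
Proof. exact: op_eq. Qed.

Lemma adjZ c X : adj (c *: X) = c^* *: adj X.
Proof. exact: op_eq. Qed.

Lemma commDl X Y Z : comm (X + Y) Z = comm X Z + comm Y Z.
Proof. by rewrite /comm mulrDl mulrDr opprD addrACA. Qed.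

Lemma commNl X Y : comm (- X) Y = - comm X Y.
Proof. by rewrite /comm mulNr mulrN opprB addrC opprK. Qed.

Lemma commN X Y : - comm X Y = comm Y X.
Proof. by rewrite /comm opprB. Qed.

(** Additive structures are inferred from a head constant; additivity of [comm]
    in its first argument needs this one. *)
Definition commr_to Y X : Op := comm X Y.

Lemma comm_is_additive Y : zmod_morphism (commr_to Y).
Proof. by move=> X Z; rewrite /commr_to commDl commNl. Qed.

HB.instance Definition _ Y :=
  GRing.isZmodMorphism.Build Op Op (commr_to Y) (comm_is_additive Y).

Lemma commr_is_additive X : zmod_morphism (comm X).
Proof.
by move=> Y Z; rewrite -commN commDl commNl opprD !commN -(commN X Z).
Qed.

HB.instance Definition _ X :=
  GRing.isZmodMorphism.Build Op Op (comm X) (commr_is_additive X).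

Lemma comm_suml I (r : seq I) P (F : I -> Op) Y :
  comm (\sum_(i <- r | P i) F i) Y = \sum_(i <- r | P i) comm (F i) Y.
Proof. exact: (raddf_sum (commr_to Y)). Qed.

Lemma comm_sumr I (r : seq I) P (F : I -> Op) X :
  comm X (\sum_(i <- r | P i) F i) = \sum_(i <- r | P i) comm X (F i).
Proof. exact: (raddf_sum (comm X)). Qed.

Lemma commMz X Y z : comm (X *~ z) Y = comm X Y *~ z.
Proof. exact: (raddfMz (commr_to Y)). Qed.

Lemma commZl c X Y : comm (c *: X) Y = c *: comm X Y.
Proof. by rewrite /comm scale_mull scale_mulr scalerBr. Qed.

Lemma commZr c X Y : comm X (c *: Y) = c *: comm X Y.
Proof. by rewrite /comm scale_mull scale_mulr scalerBr. Qed.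

Lemma comm_mull X Y Z : comm (X * Y) Z = X * comm Y Z + comm X Z * Y.
Proof. by rewrite /comm mulrBr mulrBl !mulrA addrA subrK. Qed.

Lemma comm_mulr X Y Z : comm X (Y * Z) = comm X Y * Z + Y * comm X Z.
Proof. by rewrite /comm mulrBr mulrBl !mulrA addrA subrK. Qed.

Lemma commDr X Y Z : comm X (Y + Z) = comm X Y + comm X Z.
Proof. exact: (raddfD (comm X)). Qed.

Lemma comm0l Y : comm 0 Y = 0.
Proof. exact: (raddf0 (commr_to Y)). Qed.

Lemma comm0r X : comm X 0 = 0.
Proof. exact: (raddf0 (comm X)). Qed.

Lemma comm1l Y : comm 1 Y = 0.
Proof. by rewrite /comm mul1r mulr1 subrr. Qed.

Lemma comm_scalarl c Y : comm (c *: (1 : Op)) Y = 0.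
Proof. by rewrite commZl comm1l scaler0. Qed.

Lemma comm_scalarr c X : comm X (c *: (1 : Op)) = 0.
Proof. by rewrite -commN comm_scalarl oppr0. Qed.

Lemma adj_comm X Y : adj (comm X Y) = comm (adj Y) (adj X).
Proof. by rewrite raddfB /= !adjM. Qed.

Lemma comm_jacobi X Y Z :
  comm (comm X Y) Z = comm (comm X Z) Y + comm X (comm Y Z).
Proof.
have -> : comm (comm X Y) Z = comm (X * Y) Z - comm (Y * X) Z.
  exact: (raddfB (commr_to Z)).
rewrite !comm_mull; set A := comm Y Z; set B := comm X Z.
by rewrite [in RHS]/comm [RHS]addrC [RHS]addrACA opprD [- (Y * B) - _]addrC.
Qed.

Lemma commX_eq0 X Y k : comm X Y = 0 -> comm (X ^+ k) Y = 0.
Proof.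
move=> XY; elim: k => [|k IHk]; first by rewrite expr0 comm1l.
by rewrite exprS comm_mull IHk XY mulr0 mul0r addr0.
Qed.

Lemma commX X Y k : comm X Y = 1 -> comm (X ^+ k) Y = X ^+ k.-1 *+ k.
Proof.
move=> XY; elim: k => [|k IHk].
  by rewrite expr0 comm1l.
rewrite exprS comm_mull IHk XY mul1r /=; case: k {IHk} => [|k] /=.
  by rewrite mulr0n mulr0 add0r.
by rewrite mulrnAr -exprS -mulrSr.
Qed.

(** * Polynomials in one operator *)

(** The [r]-th derivative of [\sum_(k < K) f k z^k], evaluated at [b]; the
    falling factorial vanishes for [k < r], so the truncated exponent is harmless. *)
Definition dpoly (b : Op) K (f : nat -> int) r : Op :=
  \sum_(k < K) (b ^+ (k - r)) *~ (f k * (k ^_ r)%:Z).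

Lemma dpoly_comm_eq0 b c K f r : comm b c = 0 -> comm (dpoly b K f r) c = 0.
Proof.
move=> bc; rewrite comm_suml big1 // => k _.
by rewrite commMz commX_eq0 // mul0rz.
Qed.

Lemma dpoly_comm b c K f r :
  comm b c = 1 -> comm (dpoly b K f r) c = dpoly b K f r.+1.
Proof.
move=> bc; rewrite comm_suml; apply: eq_bigr => k _.
rewrite commMz commX // pmulrn -mulrzA.
by rewrite subnS ffactnSr PoszM [_ * (_ * _) in RHS]mulrA [in LHS]mulrC.
Qed.

(** Of the [d]-th derivative of a polynomial of degree at most [d.+1] only the
    linear term is seen by commutators. *)
Lemma dpoly_comm_linear b Y K f d :
    (d.+1 < K)%N -> (forall k, (d.+1 < k < K)%N -> f k = 0) ->
  comm (dpoly b K f d) Y = comm b Y *~ (f d.+1 * (d.+1 `!)%:Z).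
Proof.
move=> dK f0; rewrite comm_suml.
have z (k : 'I_K) : k != d.+1 :> nat ->
    comm (b ^+ (k - d) *~ (f k * (k ^_ d)%:Z)) Y = 0.
  rewrite commMz neq_ltn => /orP[|dk].
    rewrite ltnS leq_eqVlt => /orP[/eqP ->|kd].
      by rewrite subnn expr0 comm1l mul0rz.
    by rewrite ffact_small // mulr0 mulr0z.
  by rewrite f0 ?mul0r ?mulr0z // dk ltn_ord.
rewrite (bigD1 (Ordinal dK)) //= [X in _ + X]big1 ?addr0; last first.
  by move=> k kd; apply: z; apply: contra kd => /eqP kd; apply/eqP/val_inj.
by rewrite commMz subSnn expr1 -ffactnn [in RHS]ffactnSr subSnn muln1.
Qed.

End Commutators.

(** * Vanishing of the top coefficients in one variable *)

Section OneMode.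
Variables (R : realType) (V : lmodType R[i]).
Variable dot : {dot V for (Num.conj : R[i] -> R[i])}.
Local Notation Op := (op dot).

Hypothesis scalar_eq0 : forall c : R[i], c *: (1 : Op) = 0 -> c = 0.

(** The commutators with [c] and [adj c] act as derivations of the two arguments
    of [\sum_v comm (C v) (adj (C v))], each killing the other argument.  If all
    degrees are at most [d >= 2], differentiating [d - 1] times on both sides
    leaves [theta] times the sum of the squares of the [d! * f v d], which is zero;
    a descending induction on [d] then removes every degree above one. *)
Lemma top_coefficients_eq0 m (C : 'I_m -> Op) (b c : Op) (theta : R[i])
    K (f : 'I_m -> nat -> int) :
    comm b c = 1 -> comm b (adj c) = 0 ->
    comm b (adj b) = theta *: (1 : Op) -> theta != 0 ->
    (forall v, comm (C v) c = dpoly b K (f v) 1) ->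
    (forall v, comm (C v) (adj c) = 0) ->
    comm (\sum_v comm (C v) (adj (C v))) c = 0 ->
  forall v k, (1 < k < K)%N -> f v k = 0.
Proof.
move=> bc bc' bb theta0 Cc Cc' Nc.
have left_derivs r : \sum_v comm (dpoly b K (f v) r.+1) (adj (C v)) = 0.
  have adjCc v : comm (adj (C v)) c = 0.
    by rewrite -[c]adjK -adj_comm -commN Cc' oppr0 raddf0.
  elim: r => [|r IHr].
    rewrite -[RHS]Nc comm_suml; apply: eq_bigr => v _.
    by rewrite comm_jacobi Cc adjCc comm0r addr0.
  transitivity (comm (\sum_v comm (dpoly b K (f v) r.+1) (adj (C v))) c).
    rewrite comm_suml; apply: eq_bigr => v _.
    by rewrite comm_jacobi (dpoly_comm _ _ _ bc) adjCc comm0r addr0.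
  by rewrite IHr comm0l.
have derivs r s :
    \sum_v comm (dpoly b K (f v) r.+1) (adj (dpoly b K (f v) s.+1)) = 0.
  have E X Y Z : comm X (adj c) = 0 -> comm Y c = Z ->
      comm (comm X (adj Y)) (adj c) = - comm X (adj Z).
    move=> Xc YZ; rewrite comm_jacobi Xc comm0l add0r -adj_comm -(commN Y c) YZ.
    by rewrite !raddfN.
  elim: s => [|s IHs]; apply: oppr_inj; rewrite oppr0 -sumrN.
    transitivity (comm (\sum_v comm (dpoly b K (f v) r.+1) (adj (C v))) (adj c)).
      rewrite comm_suml; apply: eq_bigr => v _.
      by rewrite (E _ _ (dpoly b K (f v) 1)) // dpoly_comm_eq0.
    by rewrite left_derivs comm0l.
  transitivity (comm (\sum_v comm (dpoly b K (f v) r.+1)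
                                  (adj (dpoly b K (f v) s.+1))) (adj c)).
    rewrite comm_suml; apply: eq_bigr => v _.
    rewrite (E _ _ (dpoly b K (f v) s.+2)) //; first exact: dpoly_comm_eq0.
    exact: dpoly_comm.
  by rewrite IHs comm0l.
(* [e] counts the degrees, from [K - 1] down, that are already known to vanish. *)
suff down e v k : (K <= k + e)%N -> (1 < k < K)%N -> f v k = 0.
  by move=> v k; apply: (down K); rewrite leq_addl.
elim: e v k => [|e IHe] v k.
  by rewrite addn0 => Kk /andP[_]; rewrite ltnNge Kk.
move=> Kk /andP[k1 kK]; case: k k1 kK Kk => [|[|d]] // _ dK Ke.
have top u k : (d.+2 < k < K)%N -> f u k = 0.
  move=> /andP[dk kK]; apply: IHe; last by rewrite kK (leq_trans _ dk).
  by rewrite (leq_trans Ke) // addnS -addSn leq_add2r.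
set z := fun u => f u d.+2 * (d.+2 `!)%:Z.
(* [derivs d d] involves the derivatives of order [d.+1], one less than the
   degree [d.+2] at hand. *)
have /eqP := derivs d d.
under eq_bigr => u _.
  rewrite (dpoly_comm_linear _ _ dK (top u)) -[b in comm b _]adjK -adj_comm.
  rewrite (dpoly_comm_linear _ _ dK (top u)) (raddfMz (@adj R V dot)) /=.
  rewrite adj_comm adjK bb -mulrzA -/(z u); over.
have scaleMz (y : int) : theta *: (1 : Op) *~ y = (theta *~ y) *: (1 : Op).
  by rewrite scalerMzl.
rewrite -mulrz_sumr scaleMz => /eqP /scalar_eq0 /eqP.
rewrite mulrz_eq0 (negPf theta0) orbF psumr_eq0; last first.
  by move=> u _; rewrite -expr2 sqr_ge0.
move=> /allP /(_ v (mem_index_enum v)) /=.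
rewrite mulf_eq0 orbb mulf_eq0 => /orP[/eqP // |].
by rewrite eqz_nat eqn0Ngt fact_gt0.
Qed.
End OneMode.

(** * Matrices of operators *)

Section MatrixCalculus.
Variables (R : realType) (V : lmodType R[i]).
Variable dot : {dot V for (Num.conj : R[i] -> R[i])}.
Local Notation Op := (op dot).

Lemma op_apply0 (X : Op) : X 0 = 0.
Proof. by rewrite -(scale0r (0 : V)) opZ !scale0r. Qed.

Lemma adjD (X Y : Op) : adj (X + Y) = adj X + adj Y.
Proof. exact: raddfD. Qed.

Lemma adj_sum I (r : seq I) P (F : I -> Op) :
  adj (\sum_(i <- r | P i) F i) = \sum_(i <- r | P i) adj (F i).
Proof. exact: raddf_sum. Qed.

Lemma dagM p q r (M : 'M[Op]_(p, q)) (N : 'M[Op]_(q, r)) :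
  dag (M *m N) = dag N *m dag M.
Proof.
apply/matrixP => i j; rewrite !mxE adj_sum; apply: eq_bigr => k _.
by rewrite adjM !mxE.
Qed.

Lemma dagK p q (M : 'M[Op]_(p, q)) : dag (dag M) = M.
Proof. by apply/matrixP => i j; rewrite !mxE adjK. Qed.

Lemma dag_scmx p q (M : 'M[R[i]]_(p, q)) :
  dag (scmx dot M) = scmx dot (cconj M)^T.
Proof. by apply/matrixP => i j; rewrite !mxE adjZ adj1. Qed.

Lemma mulmx_Jbar p m (M : 'M[Op]_(p, m + m)) i k :
  (M *m scmx dot (Jbar R m)) i k = Jbar R m k k *: M i k.
Proof.
rewrite mxE (bigD1 k) //= mxE scale_mulr mulr1 big1 ?addr0 // => l lk.
suff -> : scmx dot (Jbar R m) l k = 0 by rewrite mulr0.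
rewrite mxE [X in X *: _](_ : _ = 0) ?scale0r //.
case: (split_ordP l) lk => {}l ->; case: (split_ordP k) => {}k -> /=;
  rewrite ?block_mxEul ?block_mxEur ?block_mxEdl ?block_mxEdr !mxE //.
  by rewrite (inj_eq (@lshift_inj _ _)) => /negPf ->.
by rewrite (inj_eq (@rshift_inj _ _)) => /negPf ->; rewrite oppr0.
Qed.

Lemma Jbar_sign m (k : 'I_(m + m)) : Jbar R m k k = 1 \/ Jbar R m k k = - 1.
Proof.
case: (split_ordP k) => {}k ->; [left|right].
  by rewrite block_mxEul mxE eqxx.
by rewrite block_mxEdr !mxE eqxx.
Qed.

Lemma adj_iZ_comm (X Y : Op) : adj X = X -> adj ('i *: comm X Y) = 'i *: comm X (adj Y).
Proof.
by move=> XX; rewrite adjZ adj_comm XX conjCi scaleNr -scalerN commN.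
Qed.

Lemma commCE p (X : Op) (y : 'cV[Op]_p) j : commC X y j 0 = comm X (y j 0).
Proof. by rewrite mxE. Qed.

Lemma cscaleE p q c (M : 'M[Op]_(p, q)) j k : (c *:m M) j k = c *: M j k.
Proof. by rewrite mxE. Qed.

Lemma entryD p q (M N : 'M[Op]_(p, q)) j k : (M + N) j k = M j k + N j k.
Proof. by rewrite mxE. Qed.

Lemma entryB p q (M N : 'M[Op]_(p, q)) j k : (M - N) j k = M j k - N j k.
Proof. by rewrite mxE [X in _ + X]mxE. Qed.

Lemma bar_lshift p (x : 'cV[Op]_p) j : bar x (lshift p j) 0 = x j 0.
Proof. by rewrite col_mxEu. Qed.

Lemma bar_rshift p (x : 'cV[Op]_p) j : bar x (rshift p j) 0 = adj (x j 0).
Proof. by rewrite col_mxEd mxE. Qed.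

End MatrixCalculus.

(** * Consequences of the vacuum *)

Section Realizability.
Variables (R : realType) (V : lmodType R[i]).
Variable dot : {dot V for (Num.conj : R[i] -> R[i])}.
Variables (n m : nat) (S : nlsystem dot n m).
Local Notation Op := (op dot).
Implicit Types x : 'cV[Op]_n.

Lemma Theta_unit : Thetabar S \in unitmx -> Theta S \in unitmx.
Proof. by rewrite !unitmxE /Thetabar /barcN det_ublock unitrM => /andP[]. Qed.

(** A vacuum vector only serves here to exclude [V = 0], where [1 = 0]. *)
Lemma vacuum_scalar_eq0 x (c : R[i]) :
  annihilation_operators x -> c *: (1 : Op) = 0 -> c = 0.
Proof.
move=> [vac vac0 _] /(congr1 (fun X : Op => X vac)) /eqP.
by rewrite /= scaler_eq0 (negPf vac0) orbF => /eqP.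
Qed.

(** On the vacuum, [a_l a_j^*] acts as [Theta l j], so [Theta j j] is the squared
    norm of [a_j^* vac] relative to that of [vac].  Were it zero, [a_j^* vac] would
    vanish and with it the whole [j]-th column of the invertible matrix [Theta]. *)
Lemma vacuum_Theta_neq0 x j :
  Thetabar S \in unitmx -> annihilation_operators x -> ccr S x ->
  Theta S j j != 0.
Proof.
move=> /Theta_unit TU [vac vac0 kill] [ccrx _]; apply/eqP => Tj.
have ccr_vac l : x l 0 (adj (x j 0) vac) = Theta S l j *: vac.
  have : comm (x l 0) (adj (x j 0)) vac = (Theta S l j *: (1 : Op)) vac.
    by have := congr1 (fun M : 'M[Op]_n => M l j vac) ccrx; rewrite !mxE.
  rewrite -[_ *: vac]/((Theta S l j *: (1 : Op)) vac) => <-.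
  rewrite -[RHS]/(x l 0 (adj (x j 0) vac) - adj (x j 0) (x l 0 vac)).
  by rewrite kill op_apply0 subr0.
have adj_vac : adj (x j 0) vac = 0.
  apply/eqP; rewrite -(dnorm_eq0 dot) op_adjP' ccr_vac Tj scale0r.
  by rewrite linear0r.
have colj l : Theta S l j = 0.
  have := ccr_vac l; rewrite adj_vac op_apply0 => /esym/eqP.
  by rewrite scaler_eq0 (negPf vac0) orbF => /eqP.
have := congr1 (fun M : 'M[R[i]]_n => M j j) (mulVmx TU).
rewrite !mxE eqxx big1 => [|l _]; last by rewrite colj mulr0.
by move/eqP; rewrite eq_sym oner_eq0.
Qed.

(** * The Hamiltonian of a system of the class *)

Section FixedTime.
Variable x : 'cV[Op]_n.
Hypothesis ThetabarU : Thetabar S \in unitmx.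
Hypothesis Theta_neq0 : forall j, Theta S j j != 0.
Hypothesis scalar_eq0 : forall c : R[i], c *: (1 : Op) = 0 -> c = 0.
Hypothesis ccrx : ccr S x.
Hypothesis classx : in_class S x.

Local Notation C v := (Ccoef S x v 0).
Local Notation B j v := (Bcoef S x j v).

Lemma comm_a_adja p l : comm (x p 0) (adj (x l 0)) = Theta S p l *: (1 : Op).
Proof. by have [/matrixP/(_ p l)] := ccrx; rewrite !mxE. Qed.

Lemma comm_bar_adjbar j l :
  comm (bar x j 0) (adj (bar x l 0)) = Thetabar S j l *: (1 : Op).
Proof. by have [_ /matrixP/(_ j l)] := ccrx; rewrite 2!mxE [RHS]mxE. Qed.

Lemma comm_a_a p l : comm (x p 0) (x l 0) = 0.
Proof.
have := comm_bar_adjbar (lshift n p) (rshift n l).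
by rewrite bar_lshift bar_rshift adjK block_mxEur mxE scale0r.
Qed.

Lemma comm_bar_bar j l : exists c, comm (bar x j 0) (bar x l 0) = c *: (1 : Op).
Proof.
case: (split_ordP l) => {}l ->.
  exists (Thetabar S j (rshift n l)); rewrite -comm_bar_adjbar.
  by rewrite bar_lshift bar_rshift adjK.
exists (Thetabar S j (lshift n l)); rewrite -comm_bar_adjbar.
by rewrite bar_lshift bar_rshift.
Qed.

Lemma comm_C_a v l : comm (C v) (x l 0) = 0.
Proof. by have [/matrixP/(_ v l)] := classx; rewrite !mxE. Qed.

Lemma Thetabar_herm : (cconj (Thetabar S))^T = Thetabar S.
Proof.
apply/matrixP => j l; rewrite 2!mxE; apply/eqP; rewrite -subr_eq0; apply/eqP.
apply: scalar_eq0; rewrite scalerBl -comm_bar_adjbar.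
have <- : adj (comm (bar x l 0) (adj (bar x j 0))) = (Thetabar S l j)^* *: (1 : Op).
  by rewrite comm_bar_adjbar adjZ adj1.
by rewrite adj_comm adjK subrr.
Qed.

Lemma adj_adTA : adj (adTA S x) = AdTa S x.
Proof.
have -> : adj (adTA S x) =
    dag (dag (bar x) *m scmx dot (invmx (Thetabar S)) *m Abar S x) 0 0.
  by rewrite 2!mxE.
rewrite !dagM dagK dag_scmx mulmxA /cconj map_invmx trmx_inv.
by rewrite -[map_mx _ (Thetabar S)]/(cconj (Thetabar S)) Thetabar_herm.
Qed.

Lemma Hbar_selfadjoint : adj (Hbar S x) = Hbar S x.
Proof.
rewrite adjZ raddfB /= adj_adTA -adj_adTA adjK adj_adTA -opprB scalerN -scaleNr.
congr (_ *: _); rewrite rmorphM /= conjCi fmorphV rmorphM /= !conjC_nat.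
by rewrite mulNr opprK.
Qed.

(** The last equation of the class, read as: the part of the drift not due to the
    coupling is generated by [Hbar]. *)
Lemma Abar_Hbar :
  Abar S x = 2^-1 *:m (Bbar S x *m Cbar S x) + 'i *:m commC (Hbar S x) (bar x).
Proof.
have [_ _ _ class] := classx.
suff -> : 'i *:m commC (Hbar S x) (bar x) =
    Abar S x - 2^-1 *:m (Bbar S x *m Cbar S x) by rewrite addrC subrK.
rewrite -class; apply/matrixP => j k.
rewrite (ord1 k) entryB !cscaleE !commCE.
rewrite commZl scalerA mulrA -expr2 sqrCi.
by rewrite commDl commNl mulN1r scaleNr -scalerN opprB scalerBr.
Qed.

(** * Systems satisfying the coupling equation *)

Section Coupling.

Hypothesis BbarE : Bbar S x = Dcomm (Cbar S x) (bar x) *m scmx dot (Jbar R m).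

Lemma Bbar_entry j k :
  Bbar S x j k = Jbar R m k k *: comm (adj (Cbar S x k 0)) (bar x j 0).
Proof. by rewrite BbarE mulmx_Jbar [Dcomm _ _ _ _]mxE. Qed.

Lemma B_entry j v : B j v = comm (adj (C v)) (x j 0).
Proof.
have := Bbar_entry (lshift n j) (lshift m v).
rewrite !bar_lshift block_mxEul => ->.
by rewrite block_mxEul mxE eqxx scale1r.
Qed.

Lemma BC_lshift j :
  (Bbar S x *m Cbar S x) (lshift n j) 0 = \sum_v B j v * C v.
Proof.
rewrite /Bbar /Cbar /bar mul_block_col col_mxEu mul0mx addr0.
by rewrite mxE.
Qed.

Lemma BC_rshift j :
  (Bbar S x *m Cbar S x) (rshift n j) 0 = \sum_v adj (B j v) * adj (C v).
Proof.
rewrite /Bbar /Cbar /bar mul_block_col col_mxEd mul0mx add0r mxE.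
by apply: eq_bigr => v _; rewrite !mxE.
Qed.

(** The lower half of the drift is the adjoint of the upper half, and so is the
    Hamiltonian part.  Hence the coupling parts agree too, although the adjoint
    reverses the order of the factors in [B_jv * C_v]. *)
Lemma sum_comm_B_C j : \sum_v comm (B j v) (C v) = 0.
Proof.
have AE := congr1 (fun M : 'cV_(n + n) => M _ 0) Abar_Hbar.
have := AE (rshift n j); rewrite bar_rshift -bar_lshift AE.
rewrite !entryD !cscaleE !commCE adjD (adj_iZ_comm _ Hbar_selfadjoint).
rewrite bar_lshift bar_rshift => /addIr.
rewrite adjZ fmorphV /= conjC_nat => /(scalerI _).
have h : (2^-1 : R[i]) != 0 by rewrite invr_eq0 pnatr_eq0.
move=> /(_ h) /(congr1 (@adj R V dot)); rewrite adjK BC_lshift BC_rshift adj_sum.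
move=> BC.
transitivity (\sum_v (B j v * C v - adj (adj (B j v) * adj (C v)))).
  by apply: eq_bigr => v _; rewrite adjM !adjK.
by rewrite sumrB BC subrr.
Qed.

(** Since [C_v] commutes with [a_j], Jacobi moves the commutator with [a_j] onto
    [adj (C_v)], where it produces [B_jv]. *)
Lemma sum_comm_C_adjC_a j : comm (\sum_v comm (C v) (adj (C v))) (x j 0) = 0.
Proof.
transitivity (- \sum_v comm (B j v) (C v)); last by rewrite sum_comm_B_C oppr0.
rewrite comm_suml -sumrN; apply: eq_bigr => v _.
by rewrite comm_jacobi comm_C_a comm0l add0r commN B_entry.
Qed.

Lemma sum_comm_C_adjC_adja j :
  comm (\sum_v comm (C v) (adj (C v))) (adj (x j 0)) = 0.
Proof.
have := congr1 (@adj R V dot) (sum_comm_C_adjC_a j).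
rewrite raddf0 adj_comm adj_sum -commN => /eqP; rewrite oppr_eq0 => /eqP N0.
rewrite -[RHS]N0; congr comm; apply: eq_bigr => v _.
by rewrite adj_comm adjK.
Qed.

(** The couplings of a realizable system are affine: the one-variable argument
    applies in each [a_j] separately because the dual variable [c] differentiates
    with respect to [a_j] alone. *)
Lemma beta_eq0 v k j : (1 < k <= cdeg S v)%N -> beta S v k j = 0.
Proof.
move=> /andP[k1 kv].
pose c : Op := \sum_l invmx (Theta S) l j *: adj (x l 0).
(* The sums defining the [C_v] have different lengths; [f] pads them to [K]. *)
pose K := (\max_v cdeg S v).+1.
pose f v k := if (k <= cdeg S v)%N then beta S v k j else 0.
have adjc : adj c = \sum_l (invmx (Theta S) l j)^* *: x l 0.
  by rewrite adj_sum; apply: eq_bigr => l _; rewrite adjZ adjK.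
have x_c p : comm (x p 0) c = if p == j then 1 else 0.
  have -> : comm (x p 0) c = (Theta S *m invmx (Theta S)) p j *: (1 : Op).
    rewrite comm_sumr mxE scaler_suml; apply: eq_bigr => l _.
    by rewrite commZr comm_a_adja scalerA mulrC.
  rewrite mulmxV ?Theta_unit // mxE; case: eqP => _; by rewrite (scale1r, scale0r).
have comm_adjc Y : (forall l, comm Y (x l 0) = 0) -> comm Y (adj c) = 0.
  by move=> Yx; rewrite adjc comm_sumr big1 // => l _; rewrite commZr Yx scaler0.
have C_c u : comm (C u) c = dpoly (x j 0) K (f u) 1.
  have uK : ((cdeg S u).+1 <= K)%N by rewrite ltnS leq_bigmax.
  rewrite mxE comm_suml (big_ord_widen K
    (fun k => comm (\sum_(p < n) (x p 0 ^+ k) *~ beta S u k p) c) uK) big_mkcond /=.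
  apply: eq_bigr => i _; rewrite /f ltnS; case: leqP => _; last first.
    by rewrite mul0r mulr0z.
  rewrite comm_suml (bigD1 j) //= big1 ?addr0 => [|p pj].
    by rewrite commMz commX ?x_c ?eqxx // pmulrn -mulrzA ffactn1 subn1 mulrC.
  by rewrite commMz commX_eq0 ?mul0rz // x_c (negPf pj).
have kK : (1 < k < K)%N by rewrite k1 ltnS (leq_trans kv) // leq_bigmax.
have -> : beta S v k j = f v k by rewrite /f kv.
apply: (top_coefficients_eq0 scalar_eq0 _ _ (comm_a_adja j j) (Theta_neq0 j) C_c) kK.
- by rewrite x_c eqxx.
- by apply: comm_adjc => l; apply: comm_a_a.
- by move=> u; apply: comm_adjc => l; apply: comm_C_a.
rewrite comm_sumr big1 // => l _.
by rewrite commZr sum_comm_C_adjC_adja scaler0.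
Qed.

Lemma comm_C_scalar v Y :
  (forall p, exists c, comm (x p 0) Y = c *: (1 : Op)) ->
  exists c, comm (C v) Y = c *: (1 : Op).
Proof.
move=> xY; pose scalar (X : Op) := exists c, X = c *: (1 : Op).
have scalar0 : scalar 0 by exists 0; rewrite scale0r.
have scalarD X Z : scalar X -> scalar Z -> scalar (X + Z).
  by move=> [c ->] [d ->]; exists (c + d); rewrite scalerDl.
rewrite mxE comm_suml; apply: (big_ind scalar) => // k _.
rewrite comm_suml; apply: (big_ind scalar) => // p _.
rewrite commMz; case: k => -[|[|k]] /= kv.
- by rewrite expr0 comm1l mul0rz.
- by have [c ->] := xY p; rewrite scalerMzl; exists (c *~ beta S v 1 p).
by rewrite beta_eq0 ?mulr0z.
Qed.

Lemma Bbar_scalar j k : exists c, Bbar S x j k = c *: (1 : Op).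
Proof.
have bar_scalar p l : exists c, comm (x p 0) (bar x l 0) = c *: (1 : Op).
  by have := comm_bar_bar (lshift n p) l; rewrite bar_lshift.
suff [c Cc] : exists c, comm (adj (Cbar S x k 0)) (bar x j 0) = c *: (1 : Op).
  by exists (Jbar R m k k * c); rewrite Bbar_entry Cc scalerA.
case: (split_ordP k) => {}k ->; last first.
  by rewrite bar_rshift adjK; apply: comm_C_scalar => p; apply: bar_scalar.
have [|c Cc] := @comm_C_scalar k (adj (bar x j 0)).
  by move=> p; exists (Thetabar S (lshift n p) j); rewrite -comm_bar_adjbar bar_lshift.
exists (- c^* ); rewrite bar_lshift scaleNr -(adj1 dot) -adjZ -Cc.
by rewrite adj_comm adjK commN.
Qed.

Lemma comm_Bbarl j k Y : comm (Bbar S x j k) Y = 0.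
Proof. by have [c ->] := Bbar_scalar j k; apply: comm_scalarl. Qed.

Lemma comm_adjBbarr j k Y : comm Y (adj (Bbar S x j k)) = 0.
Proof.
by have [c ->] := Bbar_scalar j k; rewrite adjZ adj1 comm_scalarr.
Qed.

(** The conditions say that the flow preserves the commutation relations.  With
    [Bbar] scalar, the coupling equation identifies [comm C_k a_l^*] with
    [- J_k Bbar_lk^*], so the two drift terms each give half of the negative of the
    noise term, while the Hamiltonian terms cancel by Jacobi, the commutators
    [comm a_j a_l^*] being scalars. *)
Lemma preservation :
  commD (Abar S x) (bar x) + commD (bar x) (Abar S x)
    + Bbar S x *m scmx dot (Jbar R m) *m dag (Bbar S x) = 0.
Proof.
apply/matrixP => j l.
have Jconj k : (Jbar R m k k)^* = Jbar R m k k.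
  by case: (Jbar_sign R k) => ->; rewrite ?rmorphN rmorph1.
have JJ k : Jbar R m k k * Jbar R m k k = 1.
  by case: (Jbar_sign R k) => ->; rewrite ?mulrNN mulr1.
have Cl k i : comm (Cbar S x k 0) (adj (bar x i 0)) =
    - (Jbar R m k k *: adj (Bbar S x i k)).
  rewrite Bbar_entry adjZ Jconj scalerA JJ scale1r adj_comm adjK.
  by rewrite commN.
have Cr k i : comm (bar x i 0) (adj (Cbar S x k 0)) =
    - (Jbar R m k k *: Bbar S x i k).
  by rewrite Bbar_entry scalerA JJ scale1r commN.
pose N := \sum_k Jbar R m k k *: (Bbar S x j k * adj (Bbar S x l k)).
have BCl : comm ((Bbar S x *m Cbar S x) j 0) (adj (bar x l 0)) = - N.
  rewrite [(_ *m _) _ _]mxE comm_suml -sumrN; apply: eq_bigr => k _.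
  by rewrite comm_mull comm_Bbarl mul0r addr0 Cl mulrN scale_mulr.
have BCr : comm (bar x j 0) (adj ((Bbar S x *m Cbar S x) l 0)) = - N.
  rewrite [(_ *m _) _ _]mxE adj_sum comm_sumr -sumrN; apply: eq_bigr => k _.
  by rewrite adjM comm_mulr comm_adjBbarr mulr0 addr0 Cr mulNr scale_mull.
have -> : (commD (Abar S x) (bar x) + commD (bar x) (Abar S x)
    + Bbar S x *m scmx dot (Jbar R m) *m dag (Bbar S x)) j l =
    comm (Abar S x j 0) (adj (bar x l 0)) + comm (bar x j 0) (adj (Abar S x l 0)) + N.
  rewrite !entryD; congr (_ + _ + _); try by rewrite mxE.
  rewrite mxE; apply: eq_bigr => k _.
  by rewrite mulmx_Jbar scale_mull !mxE.
have AE i : Abar S x i 0 = 2^-1 *: (Bbar S x *m Cbar S x) i 0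
    + 'i *: comm (Hbar S x) (bar x i 0).
  by rewrite Abar_Hbar !entryD !cscaleE !commCE.
rewrite !AE adjD (adj_iZ_comm _ Hbar_selfadjoint) adjZ fmorphV /= conjC_nat.
move: (Hbar S x) => H.
rewrite commDl commDr !commZl !commZr BCl BCr addrACA -(scalerDr 'i).
have -> : comm (comm H (bar x j 0)) (adj (bar x l 0)) +
    comm (bar x j 0) (comm H (adj (bar x l 0))) = 0.
  rewrite comm_jacobi comm_bar_adjbar comm_scalarr addr0.
  by rewrite -[X in X + _]commN addNr.
rewrite scaler0 addr0 -scalerDl -mulr2n -[_ *+ 2]mulr_natr mulVf ?pnatr_eq0 //.
by rewrite scale1r mxE addNr.
Qed.

End Coupling.

(** * Realizability *)

Lemma realizes_Hbar_Cbar H L :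
  realizes S x H L -> realizes S x (Hbar S x) (Cbar S x).
Proof.
move=> [_ BE CL DE]; rewrite -CL in BE.
by split=> //; rewrite -BE; apply: Abar_Hbar.
Qed.

Lemma realizability :
  physically_realizable S x <-> realizability_conditions S x.
Proof.
split=> [[H [L /realizes_Hbar_Cbar[_ BE _ DE]]]|[_ _ _ BE DE]].
  split=> //; first exact: preservation.
    by move=> j k l; apply: comm_Bbarl.
  by move=> j k l; apply: comm_adjBbarr.
exists (Hbar S x), (Cbar S x); split=> //.
by rewrite -BE; apply: Abar_Hbar.
Qed.

End FixedTime.
End Realizability.

Theorem theorem4p1 (R : realType) (V : lmodType R[i])
    (dot : {dot V for (Num.conj : R[i] -> R[i])}) (n m : nat)
    (S : nlsystem dot n m) (F Tw : 'M[R[i]]_m)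
    (a : R -> 'cV[op dot]_n) (W bw w y : R -> 'cV[op dot]_m)
    (ThetabarU : Thetabar S \in unitmx)
    (a0_annihilation : annihilation_operators (a 0))
    (a0_ccr : ccr S (a 0))
    (W_input : input_field a W bw w F Tw)
    (a_evolution : qsde (fun t => bar (a t)) (fun t => Abar S (a t))
                        (fun t => Bbar S (a t)) (fun t => bar (W t)))
    (y_output : qsde (fun t => bar (y t)) (fun t => Cbar S (a t))
                     (fun _ => scmx dot (Dbar S)) (fun t => bar (W t)))
    (a_class : forall t, 0 <= t -> in_class S (a t))
    (TwJ : barcN Tw = Jbar R m) :
  forall t, 0 <= t -> ccr S (a t) ->
    (physically_realizable S (a t) <-> realizability_conditions S (a t)) /\
    (physically_realizable S (a t) ->
      adj (Hbar S (a t)) = Hbar S (a t) /\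
      realizes S (a t) (Hbar S (a t)) (Cbar S (a t)) /\
      (forall H L, realizes S (a t) H L -> L = Cbar S (a t))).
Proof.
move=> t t0 ccrt; have classt := a_class t t0.
have scalar_eq0 (c : R[i]) : c *: (1 : op dot) = 0 -> c = 0.
  exact: vacuum_scalar_eq0 a0_annihilation.
have Theta_neq0 j : Theta S j j != 0.
  exact: vacuum_Theta_neq0 ThetabarU a0_annihilation a0_ccr.
split; first exact: realizability.
move=> [H [L real]]; split; first exact: Hbar_selfadjoint.
split; first exact: realizes_Hbar_Cbar real.
by move=> H' L' [_ _ CL _].
Qed.
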